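(* Let $X, Y$ be compact metric spaces and let $\{f_n\}_{n\in\mathbb{N}}$ be an approximative map from $X$ to $Y$. Then there exists an approximative map $\{\mathfrak{f}_n\}_{n\in\mathbb{N}}$ of finite type from $X$ to $Y$ that is homotopic to $\{f_n\}_{n\in\mathbb{N}}$.
   Context: For a compact metric space $Y$, the hyperspace $2^Y$ is the set of non-empty closed subsets of $Y$. $2^Y_u$ denotes $2^Y$ endowed with the upper semifinite topology, whose base consists of the sets $B(V)=\{C\in 2^Y : C\subset V\}$ for $V\subset Y$ open. The canonical copy of $Y$ in $2^Y_u$ is $\{\{y\}: y\in Y\}$. For $U\subset 2^Y_u$ and continuous maps $f,g:X\to 2^Y_u$, ''$f$ is homotopic to $g$ in $U$'' (written $f\simeq_U g$) means that there is a continuous map $H:X\times I\to U$, $I=[0,1]$ and $U$ carrying the subspace topology, with $H(x,0)=f(x)$ and $H(x,1)=g(x)$ for all $x\in X$. An approximative map from $X$ to $Y$ is a sequence $\{f_n\}_{n\in\mathbb{N}}$ of continuous maps $f_n:X\to 2^Y_u$ such that for every neighborhood $U$ of the canonical copy of $Y$ in $2^Y_u$ there exists $n_0\in\mathbb{N}$ such that $f_n$ is homotopic to $f_{n+1}$ in $U$ for every $n>n_0$. Two approximative maps $\{f_n\}$ and $\{g_n\}$ from $X$ to $Y$ are homotopic if for every open neighborhood $U$ of the canonical copy of $Y$ in $2^Y_u$ there exists $n_0\in\mathbb{N}$ such that $f_n$ is homotopic to $g_n$ in $U$ for every $n>n_0$. An approximative map $\{f_n\}_{n\in\mathbb{N}}$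 from $X$ to $Y$ is of finite type if for every $n\in\mathbb{N}$ and every $x\in X$ the set $f_n(x)$ is finite. *)

(* Defs.v *)
From HB Require Import structures.
From mathcomp Require Import all_boot all_order all_algebra.
From mathcomp Require Import all_classical all_reals all_analysis.

Set Implicit Arguments.
Unset Strict Implicit.
Unset Printing Implicit Defensive.

Import Order.TTheory GRing.Theory Num.Theory.
Import numFieldTopology.Exports.

Local Open Scope classical_set_scope.
Local Open Scope ring_scope.

(* [hyperspace Y] always carries the upper semifinite topology below, so it
   plays the role of both 2^Y and 2^Y_u. *)
Record hyperspace (Y : topologicalType) := Hyperspace {
  hset :> set Y;
  hset_closed : closed hset;
  hset_neq0 : hset !=set0 }.

HB.instance Definition _ (Y : topologicalType) := gen_eqMixin (hyperspace Y).
HB.instance Definition _ (Y : topologicalType) :=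
  gen_choiceMixin (hyperspace Y).

Definition usf_base (Y : topologicalType) (V : set Y) : set (hyperspace Y) :=
  [set C | hset C `<=` V].

Section UpperSemifinite.
Variable Y : topologicalType.

Let usf_base_cover : \bigcup_(V in [set V | open V]) @usf_base Y V = setT.
Proof. by rewrite predeqE => C; split=> // _; exists setT => //; exact: openT. Qed.

Let usf_base_join (V W : set Y) (C : hyperspace Y) :
  [set V | open V] V -> [set V | open V] W -> usf_base V C -> usf_base W C ->
  exists O, [/\ [set V | open V] O, usf_base O C &
                usf_base O `<=` usf_base V `&` usf_base W].
Proof.
move=> oV oW CV CW; exists (V `&` W); split; first exact: openI.
  by move=> y Cy; split; [exact: CV|exact: CW].
by move=> D DVW; split=> y /DVW[].
Qed.

HB.instance Definition _ := isBaseTopological.Build (hyperspace Y)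
  usf_base_cover usf_base_join.

End UpperSemifinite.

Definition canonical_copy (Y : topologicalType) : set (hyperspace Y) :=
  [set C | exists y, hset C = [set y]].

Section Homotopy.
Variable R : realType.

Definition unit_interval : topologicalType := set_type `[(0 : R), 1]%classic.

Fact ui_mem0 : (0 : R) \in `[(0 : R), 1]%classic.
Proof. by rewrite inE /= in_itv /= lexx ler01. Qed.
Fact ui_mem1 : (1 : R) \in `[(0 : R), 1]%classic.
Proof. by rewrite inE /= in_itv /= lexx ler01. Qed.

Definition ui0 : unit_interval := exist _ 0 ui_mem0.
Definition ui1 : unit_interval := exist _ 1 ui_mem1.

Variables X Y : topologicalType.

(* [set_type U], like [unit_interval], carries the initial topology of the
   inclusion, i.e. the subspace topology. *)
Definition homotopic_in (U : set (hyperspace Y)) (f g : X -> hyperspace Y) :=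
  exists H : X * unit_interval -> set_type U,
    [/\ continuous H,
        forall x, set_val (H (x, ui0)) = f x &
        forall x, set_val (H (x, ui1)) = g x].

Definition approximative_map (f : nat -> X -> hyperspace Y) :=
  (forall n, continuous (f n)) /\
  forall U : set (hyperspace Y), set_nbhs (@canonical_copy Y) U ->
    exists n0, forall n, (n0 < n)%N -> homotopic_in U (f n) (f n.+1).

Definition homotopic_approximative_maps (f g : nat -> X -> hyperspace Y) :=
  forall U : set (hyperspace Y), open U -> @canonical_copy Y `<=` U ->
    exists n0, forall n, (n0 < n)%N -> homotopic_in U (f n) (g n).

Definition of_finite_type (f : nat -> X -> hyperspace Y) :=
  forall n x, finite_set (hset (f n x)).

End Homotopy.

(* Main.v *)
(* Fix finite (1/(n+1))-nets A_n of Y and let q_n send a closed set C to the set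
   of all points of A_n that are nearest to some point of C; q_n is continuous
   for the upper semifinite topology, and g_n := q_n o f_n.  If K is a homotopy
   from f_n to f_{n+1} through small sets, then q_n o K and q_{n+1} o K are
   close to K, and one passes from the first to the second by using q_n o K for
   t < 1/2, q_{n+1} o K for t > 1/2 and their union at t = 1/2.  A Lebesgue
   number argument shows that every neighbourhood of the canonical copy contains
   all sufficiently small sets. *)
Require Import Defs.
From mathcomp Require Import all_boot all_order all_algebra.
From mathcomp Require Import all_classical all_reals all_analysis.
From mathcomp Require Import lra.

Set Implicit Arguments.
Unset Strict Implicit.
Unset Printing Implicit Defensive.

Import Order.TTheory GRing.Theory Num.Theory.
Import numFieldTopology.Exports.

Local Open Scope classical_set_scope.
Local Open Scope ring_scope.

(** * Neighbourhoods and continuity in the upper semifinite topology *)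

Section UpperSemifiniteTopology.
Variable Y : topologicalType.

Lemma open_usf_base (V : set Y) : open V -> open (@usf_base Y V).
Proof.
move=> oV; exists [set V]; first by move=> _ ->.
by rewrite bigcup_set1.
Qed.

Lemma nbhs_hyperspaceP (C : hyperspace Y) (U : set (hyperspace Y)) :
  nbhs C U <-> exists2 V, open V & C `<=` V /\ usf_base V `<=` U.
Proof.
rewrite nbhsE; split=> [[B [[D DO <-] [V DV CV]] BU]|[V oV [CV VU]]].
  exists V; first exact: DO.
  by split=> // E EV; apply: BU; exists V.
by exists (usf_base V) => //; split=> //; exact: open_usf_base.
Qed.

(** This is upper semicontinuity of a set-valued map, the form in which continuity is checked for
    [switch] and [nearest]. *)
Lemma continuous_hyperspaceP (T : topologicalType) (F : T -> hyperspace Y) :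
  continuous F <->
  forall p V, open V -> F p `<=` V -> \forall q \near p, F q `<=` V.
Proof.
split=> [cF p V oV FpV|H p U /nbhs_hyperspaceP[V oV [FpV VU]]].
  by apply: (cF p (usf_base V)); apply/nbhs_hyperspaceP; exists V => //; split.
by apply: filterS (H p V oV FpV) => q /VU.
Qed.

Definition hyperspaceU (C D : hyperspace Y) : hyperspace Y.
Proof.
exists (hset C `|` hset D).
  by apply: closedU; exact: hset_closed.
by have [y Cy] := hset_neq0 C; exists y; left.
Defined.

End UpperSemifiniteTopology.

(** * Joining two set-valued homotopies at time 1/2 *)

Section Switch.
Variables (R : realType) (X Y : topologicalType).
Implicit Types (U : set (hyperspace Y)) (f g : X -> hyperspace Y).
Let XI : topologicalType := (X * unit_interval R)%type.

(** Trades maps into the subtype [set_type U] for maps into the whole hyperspace that stay in [U],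
    so that homotopies can be composed and glued without carrying membership proofs. *)
Lemma homotopic_inP U f g : homotopic_in R U f g <->
  exists H : XI -> hyperspace Y,
    [/\ continuous H, forall p, U (H p), forall x, H (x, ui0 R) = f x &
        forall x, H (x, ui1 R) = g x].
Proof.
split=> [[H [cH H0 H1]]|[H [cH HU H0 H1]]].
  exists (fun p => set_val (H p)); split=> // p.
    by apply: continuous_comp; [exact: cH|exact: initial_continuous].
  exact: set_valP.
exists (fun p => exist _ (H p) (mem_set (HU p))); split=> //.
exact: continuous_comp_initial.
Qed.

Variables K1 K2 : XI -> hyperspace Y.

(* Taking the union at t = 1/2 is what makes the switch upper semicontinuous. *)
Definition switch (p : XI) : hyperspace Y :=
  if set_val p.2 < 2^-1 :> R then K1 p
  else if 2^-1 < set_val p.2 :> R then K2 p else hyperspaceU (K1 p) (K2 p).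

(** The two time conditions overlap at 1/2, where the value is a union; this decouples [K1] from
    [K2] in continuity arguments. *)
Lemma switch_subE p (V : set Y) : switch p `<=` V <->
  (set_val p.2 <= 2^-1 :> R -> K1 p `<=` V) /\
  (2^-1 <= set_val p.2 :> R -> K2 p `<=` V).
Proof.
rewrite /switch; case: ltgtP => // _; split=> //; rewrite ?subUset.
- by case=> + _; apply.
- by case=> _; apply.
- by case.
- by case=> /(_ isT) ? /(_ isT) ?.
Qed.

Lemma continuous_switch : continuous K1 -> continuous K2 -> continuous switch.
Proof.
move=> /continuous_hyperspaceP cK1 /continuous_hyperspaceP cK2.
have ct : continuous (fun p : XI => set_val p.2 : R).
  move=> p; apply: (@continuous_comp _ _ _ snd set_val); first exact: cvg_snd.
  exact: initial_continuous.
apply/continuous_hyperspaceP => p V oV /switch_subE[K1V K2V].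
(* If the time at [p] is at most 1/2, semicontinuity of [K1] applies; otherwise nearby times also
   exceed 1/2 and the implication is vacuous. *)
have near1 : \forall q \near p, set_val q.2 <= 2^-1 :> R -> K1 q `<=` V.
  have [/K1V/cK1 h|lt] := leP (set_val p.2 : R) 2^-1.
    by apply: filterS (h oV).
  have near_t : \forall q \near p, 2^-1 < set_val q.2 :> R.
    exact: ct (lt_nbhsr lt).
  by apply: filterS near_t => q ? ?; lra.
have near2 : \forall q \near p, 2^-1 <= set_val q.2 :> R -> K2 q `<=` V.
  have [/K2V/cK2 h|lt] := leP 2^-1 (set_val p.2 : R).
    by apply: filterS (h oV).
  have near_t : \forall q \near p, set_val q.2 < 2^-1 :> R.
    exact: ct (lt_nbhsl lt).
  by apply: filterS near_t => q ? ?; lra.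
by apply: filterS2 near1 near2 => q ? ?; apply/switch_subE.
Qed.

Lemma switch_homotopic U f g : continuous K1 -> continuous K2 ->
    (forall p (C : hyperspace Y), C `<=` K1 p `|` K2 p -> U C) ->
    (forall x, K1 (x, ui0 R) = f x) -> (forall x, K2 (x, ui1 R) = g x) ->
  homotopic_in R U f g.
Proof.
move=> c1 c2 h K1f K2g; apply/homotopic_inP; exists switch.
split; first exact: continuous_switch.
- move=> p; apply: (h p); apply/switch_subE.
  by split=> _ y; [left|right].
- by move=> x; rewrite /switch /= invr_gt0 ltr0n K1f.
- have half1 : 2^-1 < 1 :> R by lra.
  by move=> x; rewrite /switch /= ltNge ltW //= half1 K2g.
Qed.

End Switch.

(** * Nearest-point maps onto finite nets *)

Section NearestPoints.
Variables (R : realType) (Y : metricType R).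
Implicit Types (A : set Y) (c a : Y).

(** For [a] in [A], this is the closed Voronoi cell of [a] with respect to [A]. *)
Definition closer_in A a : set Y :=
  [set c | forall b, A b -> mdist c a <= mdist c b].

Lemma closed_closer_in A a : closed (closer_in A a).
Proof.
rewrite (_ : closer_in A a =
    \bigcap_(b in A) [set c | mdist c a <= mdist c b]); last first.
  by apply/seteqP; split.
apply: closed_bigI => b _; rewrite -openC openE => c /=/negP.
rewrite -ltNge => lt_ba; apply/nbhs_ballP.
(* Moving [c] by less than half the gap changes each of the two distances by less than half the gap,
   so the strict inequality survives. *)
exists ((mdist c a - mdist c b) / 2) => /=; first lra.
rewrite ballEmdist => c' /= cc'; apply/negP; rewrite -ltNge.
have := metric_triangle c c' a; have := metric_triangle c' c b.
rewrite (metric_sym c' c); lra.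
Qed.

Lemma finite_argmin (T : choiceType) (A : set T) (F : T -> R) :
  finite_set A -> A !=set0 -> exists2 a, A a & forall b, A b -> F a <= F b.
Proof.
move=> /finite_seqP[s ->]; elim: s => [[]//|x s IHs _] /=.
have [->|s0] := eqVneq s [::].
  by exists x; rewrite /= ?inE // => b; rewrite inE => /eqP->.
have [] := IHs.
  by case: s s0 {IHs} => // y s _; exists y; rewrite /= inE eqxx.
move=> a /= sa amin; have [Fxa|Fax] := leP (F x) (F a).
  exists x => [|b]; rewrite /= inE ?eqxx // => /orP[/eqP->//|/amin].
  exact: le_trans.
exists a => [|b]; rewrite /= inE ?sa ?orbT // => /orP[/eqP->|/amin//].
exact: ltW.
Qed.

Variables (A : set Y) (finA : finite_set A) (A0 : Y -> A !=set0).

(** [A0] asks for a point of [Y] because [Y], and then [A], may be empty; the non-empty set [C]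
    supplies the point. *)
Definition nearest (C : hyperspace Y) : hyperspace Y.
Proof.
exists [set a | A a /\ exists2 c, hset C c & closer_in A a c].
  have := hausdorff_accessible (@metric_hausdorff _ Y).
  move/accessible_finite_set_closed.
  by apply; apply: sub_finite_set finA => a [].
have [c Cc] := hset_neq0 C.
by have [a Aa amin] := finite_argmin (mdist c) finA (A0 c); exists a; split=> //;
  exists c.
Defined.

Lemma finite_nearest C : finite_set (nearest C).
Proof. by apply: sub_finite_set finA => a []. Qed.

(** The image of [C] lies in [V] exactly when [C] misses the Voronoi cells of all points of [A]
    outside [V]; these are finitely many closed sets, so the condition is open. *)
Lemma continuous_nearest : continuous nearest.
Proof.
apply/continuous_hyperspaceP => C V oV CV; apply/nbhs_hyperspaceP.
exists (~` \bigcup_(a in A `\` V) closer_in A a).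
  rewrite openC; apply: closed_bigcup; first exact: finite_setD.
  by move=> a _; exact: closed_closer_in.
split=> [c Cc [a [Aa Va]] ca|D DW a [Aa [c Dc ca]]].
  by apply/Va/CV; split=> //; exists c.
by apply: contrapT => Va; apply: (DW c Dc); exists a.
Qed.

(** The net has a point within [e] of [c], and [a] is at least as near to [c]. *)
Lemma nearest_close (e : R) C : (forall y, exists2 a, A a & ball y e a) ->
  forall a, hset (nearest C) a -> exists2 c, hset C c & ball c e a.
Proof.
move=> net a [Aa [c Cc ca]]; exists c => //.
have [b Ab] := net c; rewrite !ballEmdist /=; apply: le_lt_trans; exact: ca.
Qed.

End NearestPoints.

Lemma compact_finite_net (R : realType) (Y : metricType R) (e : R) :
    compact [set: Y] -> 0 < e ->
  exists A : set Y, finite_set A /\ forall y, exists2 a, A a & ball y e a.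
Proof.
move=> /compact_near_coveringP cY e0.
(* [compact_cover] requires a pointed type, whereas Y may be empty here; the
   near-covering property is used along the filter of large finite sets. *)
pose F := filter_from [set A : set Y | finite_set A]
                      (fun A => [set B | finite_set B /\ A `<=` B]).
have FF : Filter F.
  apply: filter_from_filter; first by exists set0; exact: finite_set0.
  move=> A B fA fB; exists (A `|` B); first by rewrite /= finite_setU.
  by move=> C [fC]; rewrite subUset => -[? ?].
have [y _|A fA] := cY _ F (fun A y => exists2 a, A a & ball y e a) FF.
  exists (ball y e, [set B | finite_set B /\ [set y] `<=` B]).
    split; first exact: near_ball.
    by exists [set y] => //; exact: finite_set1.
  by move=> [y' B] /= [yy' [_ yB]]; exists y; [exact: yB|exact: ball_sym].
by move=> /(_ A (conj fA (@subset_refl _ A))) netA; exists A;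
  split=> // y; exact: netA.
Qed.

(** * Small sets as a neighbourhood base of the canonical copy *)

Section SmallSets.
Variables (R : realType) (Y : metricType R).

Definition small_sets (e : R) : set (hyperspace Y) :=
  [set C | exists y, C `<=` ball y e].

Lemma set_nbhs_small_sets (e : R) :
  0 < e -> set_nbhs (@canonical_copy Y) (small_sets e).
Proof.
move=> e0 C [y Cy]; apply/nbhs_hyperspaceP; exists (ball y e)°.
  exact: open_interior.
split; first by move=> z; rewrite Cy => ->; exact: near_ball.
by move=> D De; exists y => z /De; exact: interior_subset.
Qed.

Lemma small_sets_sub_nbhs (U : set (hyperspace Y)) :
    compact [set: Y] -> set_nbhs (@canonical_copy Y) U ->
  exists2 e : R, 0 < e & small_sets e `<=` U.
Proof.
move=> /compact_near_coveringP cY nU.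
have near_e : \forall e \near (0 : R)^'+, [set: Y] `<=`
    (fun y => usf_base (ball y e) `<=` U).
  apply: cY => y _.
  pose Cy : hyperspace Y := Hyperspace
    (accessible_closed_set1
       (hausdorff_accessible (@metric_hausdorff _ Y)) (x:=y))
    (ex_intro _ y erefl).
  have /nbhs_hyperspaceP[V oV [yV VU]] : nbhs Cy U by apply: nU; exists y.
  have /nbhs_ballP[r /= r0 rV] : nbhs y V.
    by apply: open_nbhs_nbhs; split=> //; exact: yV.
  (* A ball of radius below r/2 centred within r/2 of [y] stays inside the ball of radius [r], hence
     inside [V]. *)
  exists (ball y (r / 2), [set e | e < r / 2]).
    split; first by apply: near_ball; lra.
    by apply: nbhs_right_lt; lra.
  move=> [y' e] /= [yy' er] C Ce; apply: VU => z /Ce y'z; apply: rV.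
  apply: (@le_ball _ _ _ (r / 2 + e)); first lra.
  exact: ball_triangle yy' y'z.
near (0 : R)^'+ => e; exists e => // C [y Cy].
have eU : [set: Y] `<=` (fun y => usf_base (ball y e) `<=` U) by near: e.
exact: (eU y).
Unshelve. all: by end_near. Qed.

(** [K] is a common reference: at each time a single ball of radius [d] contains its value, and
    enlarging the radius by [e] captures both [K1] and [K2], hence their union. *)
Lemma homotopic_close (X : topologicalType) (d e : R)
    (K K1 K2 : X * unit_interval R -> hyperspace Y) (f g : X -> hyperspace Y) :
    continuous K1 -> continuous K2 -> (forall p, small_sets d (K p)) ->
    (forall p y, hset (K1 p) y -> exists2 c, hset (K p) c & ball c e y) ->
    (forall p y, hset (K2 p) y -> exists2 c, hset (K p) c & ball c e y) ->
    (forall x, K1 (x, ui0 R) = f x) -> (forall x, K2 (x, ui1 R) = g x) ->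
  homotopic_in R (small_sets (d + e)) f g.
Proof.
move=> c1 c2 Kd K1e K2e K1f K2g; apply: switch_homotopic K1f K2g => // p C CK.
have [y Ky] := Kd p; exists y => z /CK.
by move=> [/K1e|/K2e] [c /Ky yc cz]; exact: ball_triangle yc cz.
Qed.

End SmallSets.

(** * Replacing each map by its finite approximation *)

Lemma homotopic_in_sub (R : realType) (X Y : topologicalType)
    (U V : set (hyperspace Y)) (f g : X -> hyperspace Y) :
  U `<=` V -> homotopic_in R U f g -> homotopic_in R V f g.
Proof.
move=> UV /homotopic_inP[H [cH HU H0 H1]]; apply/homotopic_inP; exists H.
by split=> // p; exact/UV/HU.
Qed.

Theorem theorem1 (R : realType) (X Y : metricType R)
    (compactX : compact [set: X]) (compactY : compact [set: Y])
    (f : nat -> X -> hyperspace Y) (hf : approximative_map R f) :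
  exists g : nat -> X -> hyperspace Y,
    [/\ approximative_map R g, of_finite_type g &
        homotopic_approximative_maps R g f].
Proof.
have [cf hom_f] := hf.
pose e n : R := n.+1%:R^-1.
have e_gt0 n : 0 < e n by rewrite invr_gt0 ltr0n.
have [A A_net] := choice (fun n => compact_finite_net compactY (e_gt0 n)).
have finA n : finite_set (A n) by case: (A_net n).
have netA n y : exists2 a, A n a & ball y (e n) a by case: (A_net n).
have A0 n (y : Y) : A n !=set0 by have [a Aa _] := netA n y; exists a.
pose q n := nearest (finA n) (A0 n).
have cq n : continuous (q n) by exact: continuous_nearest.
pose g n x := q n (f n x).
have cg n : continuous (g n).
  by move=> x; apply: continuous_comp; [exact: cf|exact: cq].
have q_close n d C : e n <= d ->
    forall a, hset (q n C) a -> exists2 c, hset C c & ball c d a.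
  move=> nd a /(nearest_close (netA n))[c Cc ca]; exists c => //.
  exact: le_ball ca.
(* Half of the radius that fits in [U] goes to the size of the sets along the given homotopies, the
   other half to the mesh of the nets. *)
have eventually_small U : set_nbhs (@canonical_copy Y) U -> exists d n0,
    [/\ 0 < d, small_sets (d + d) `<=` U, forall n, (n0 < n)%N -> e n <= d &
     forall n, (n0 < n)%N -> homotopic_in R (small_sets d) (f n) (f n.+1)].
  move=> /(small_sets_sub_nbhs compactY)[d d0 dU].
  have d20 : 0 < d / 2 by rewrite divr_gt0.
  have [n1 hn1] := hom_f _ (set_nbhs_small_sets d20).
  have [n2 _ hn2] := near_infty_natSinv_lt (PosNum d20).
  exists (d / 2), (maxn n1 n2); split=> //; first by rewrite -splitr.
    by move=> n; rewrite gtn_max => /andP[_ /ltnW/hn2/ltW].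
  by move=> n; rewrite gtn_max => /andP[/hn1].
exists g; split; last 2 first.
- by move=> n x; exact: finite_nearest.
- move=> U oU cU.
  have nU : set_nbhs (@canonical_copy Y) U.
    by move=> C /cU UC; exact: open_nbhs_nbhs.
  have [d [n0 [d0 dU en hn]]] := eventually_small U nU.
  exists n0 => n n0n; apply: homotopic_in_sub dU _.
  have /homotopic_inP[K [cK Kd K0 K1]] := hn n n0n.
  (* All three families are constant in time. The homotopy from [f n] to [f n.+1] serves only to
     show, at time 0, that the values of [f n] are small. *)
  apply: (@homotopic_close _ _ _ _ _ (fun p => f n p.1)
    (fun p => g n p.1) (fun p => f n p.1)) => //.
  + by move=> p; apply: (@continuous_comp _ _ _ fst (g n));
      [exact: cvg_fst|exact: cg].
  + by move=> p; apply: (@continuous_comp _ _ _ fst (f n));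
      [exact: cvg_fst|exact: cf].
  + by move=> [x t]; rewrite -K0; exact: Kd.
  + by move=> p; exact/q_close/en.
  + by move=> p y fy; exists y => //; exact: ballxx.
- split=> // U nU.
  have [d [n0 [d0 dU en hn]]] := eventually_small U nU.
  exists n0 => n n0n; apply: homotopic_in_sub dU _.
  have /homotopic_inP[K [cK Kd K0 K1]] := hn n n0n.
  (* Both discretisations follow the same [K]; the switch changes the net from [A n] to [A n.+1]
     while [K] moves from [f n] to [f n.+1]. *)
  apply: (@homotopic_close _ _ _ _ _ K (q n \o K) (q n.+1 \o K)) => //.
  + by move=> p; apply: continuous_comp; [exact: cK|exact: cq].
  + by move=> p; apply: continuous_comp; [exact: cK|exact: cq].
  + by move=> p; exact/q_close/en.
  + by move=> p; apply/q_close/en; exact: ltnW.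
  + by move=> x; rewrite /= K0.
  + by move=> x; rewrite /= K1.
Qed.
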